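(* Let $q\ge3$, let $\mathbb{T}_q$ be the homogeneous tree of degree $q$ with root $e$, and let $(A(n))_{n\ge1}$ be the Internal DLA on $\mathbb{T}_q$ started at $e$ and associated with the Simple Random Walk. Let $V(n)=\#B(n)$, where $B(r)$ is the ball of radius $r$ around $e$. Then for any constant $C_i<1/(2\ln(q-1))$, $$\mathbb{P}\left[A(V(n))^c\cap B(n-C_i\ln n)\neq\emptyset\ \text{ for infinitely many } n\right]=1 .$$
   Context: $\mathbb{T}_q$ is the infinite tree in which every vertex has exactly $q$ neighbours, with a distinguished vertex $e$; $|z|$ denotes the graph distance from $e$ to $z$. The Simple Random Walk is the nearest neighbour Markov chain on $\mathbb{T}_q$ moving at each step to a uniformly chosen neighbour. For real $r$, $B(r)=\{z:|z|\le r\}$. (These balls coincide with the balls $\{z:d(e,z)\le Kr\}$ for the hitting distance $d(x,y)=-\ln F(x,y)$, where $F(x,y)$ is the probability that the walk started at $x$ ever hits $y$ and $K=\ln(q-1)$, since $F(e,z)=(q-1)^{-|z|}$.) One has $V(n)=\frac{q(q-1)^n-2}{q-2}$ for integers $n\ge 0$. The superscript $c$ denotes the complement in $\mathbb{T}_q$. Internal DLA: let $(S^n(\cdot))_{n\ge1}$ be i.i.d. Simple Random Walks on $\mathbb{T}_q$, all started at $e$. Define random finite sets by $A(1)=\{e\}$ and $A(n+1)=A(n)\cup\{S^{n+1}(\tau_{A(n)^c})\}$, where $\tau_{A(n)^c}$ is the first time $k\ge 0$ at which $S^{n+1}(k)\notin A(n)$ (almost surely finite). The index $n$ ranges over positive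 integers. *)

(* Defs.v *)
From HB Require Import structures.
From mathcomp Require Import all_boot all_order all_algebra.
From mathcomp Require Import finmap.
From mathcomp Require Import all_classical all_reals all_analysis.

Set Implicit Arguments.
Unset Strict Implicit.
Unset Printing Implicit Defensive.

Import Order.TTheory GRing.Theory Num.Theory.

Local Open Scope classical_set_scope.
Local Open Scope ring_scope.

(* A connected simple graph without cycles in which every vertex has exactly q
   neighbours. For q >= 2 it is automatically infinite, and it is unique up to
   isomorphism. A cycle is a closed path through at least three pairwise
   distinct vertices. *)
Record homogeneousTree (q : nat) := HomogeneousTree {
  vertex :> choiceType;
  adj : rel vertex;
  adj_sym : symmetric adj;
  adj_irr : irreflexive adj;
  adj_connected : forall x y, exists p, path adj x p /\ last x p = y;
  adj_acyclic : forall c, (2 < size c)%N -> ~ ucycle adj c;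
  adj_regular : forall x, ([set y | adj x y] #= `I_q)%card
}.

Section Tree.
Context (q : nat) (T : homogeneousTree q).
Implicit Types x y e : T.

Definition joined x y (n : nat) : bool :=
  `[< exists p, [/\ path (@adj q T) x p, last x p = y & size p = n] >].

Lemma joined_ex x y : exists n, joined x y n.
Proof.
by have [p [? ?]] := adj_connected x y; exists (size p); apply/asboolP; exists p.
Qed.

Definition graph_dist x y : nat := ex_minn (joined_ex x y).

Definition tree_ball (R : realType) e (r : R) : set T :=
  [set z | (graph_dist e z)%:R <= r].

(* [fset_set] is the empty set on infinite sets, but these balls are finite. *)
Definition ball_volume (R : realType) e (n : nat) : nat :=
  #|` fset_set (tree_ball e (n%:R : R)) |.

Definition srw_kernel (R : realType) x y : R :=
  if adj x y then q%:R^-1 else 0.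

End Tree.

Section Walks.
Context (q : nat) (T : homogeneousTree q).
Context d (Omega : measurableType d) (R : realType) (P : probability Omega R).

(* The Markov property is stated in multiplicative form, to avoid conditioning
   on null events. *)
Definition simple_random_walk (e : T) (X : nat -> Omega -> T) : Prop :=
  [/\ forall k x, measurable (X k @^-1` [set x]),
      P (X 0 @^-1` [set e]) = 1%E
    & forall (k : nat) (x : nat -> T),
        P [set w | forall i, (i <= k.+1)%N -> X i w = x i] =
        (P [set w | forall i, (i <= k)%N -> X i w = x i] *
         (srw_kernel R (x k) (x k.+1))%:E)%E].

(* The vertex set is countable, so events of the form X_k = x suffice to
   generate the sigma-algebra of the process. *)
Definition process_sigma (X : nat -> Omega -> T) : set (set Omega) :=
  <<s [set E | exists k x, E = X k @^-1` [set x]] >>.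

Definition independent_processes (S : nat -> nat -> Omega -> T) : Prop :=
  forall (I : seq nat) (E : nat -> set Omega), uniq I ->
    (forall i, i \in I -> process_sigma (S i) (E i)) ->
    P (\bigcap_(i in [set` I]) E i) = (\prod_(i <- I) P (E i))%E.

End Walks.

Section IDLA.
Context (q : nat) (T : homogeneousTree q) (Omega : Type).

Definition first_exit (A : set T) (s : nat -> T) (k : nat) : Prop :=
  ~ A (s k) /\ forall j, (j < k)%N -> A (s j).

(* The index starts at 1; the value at index 0 is irrelevant. If a walk never
   leaves the current cluster (a null event), nothing is added. *)
Fixpoint idla (e : T) (S : nat -> nat -> Omega -> T) (n : nat) (w : Omega)
    : set T :=
  if n is m.+1 then
    if m is 0 then [set e]
    else idla e S m w `|`
      [set z | exists2 k, first_exit (idla e S m w) (fun j => S n j w) k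
                        & S n k w = z]
  else set0.

End IDLA.

(* Main.v *)
Require Import Defs.
From HB Require Import structures.
From mathcomp Require Import all_boot all_order all_algebra.
From mathcomp Require Import finmap.
From mathcomp Require Import all_classical all_reals all_analysis.
From mathcomp Require Import measurable_realfun.
From mathcomp Require Import zify ring lra.

Import Order.TTheory GRing.Theory Num.Theory.

Local Open Scope classical_set_scope.
Local Open Scope ring_scope.

(** A vertex outside the union of the ranges of the first [N] walks is outside
    [A(N)], so it is enough to find vertices that the unstopped walks all miss.
    Put [b = q - 1]. A walk hits [z] with probability at most [b^-|z|], and both
    [z] and [z'] with probability at most [(b^-|z| + b^-|z'|) b^-d(z,z')].
    Take [n = b^(2l)], so that [C ln n < l], and choose below each vertex of
    level [n - 3l] one vertex of level [n - l]; the chosen vertices are more than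
    [2l] apart. As [V(n) <= q b^n], each of them is missed by all [V(n)] walks
    with probability at least [b^(-4 q b^l)], so the mean number of missed ones is
    at least [b^l], while two distinct ones are missed independently up to a
    factor [1 + O(b^-l)]. By the second moment method some chosen vertex is missed
    with probability [1 - O(b^-l)]. Letting [l] tend to infinity, the limsup of
    the events has probability [1]; no independence between different [n] is
    needed. *)

(** * Distances, ancestors and spheres in the tree *)

Section TreeMetric.
Set Implicit Arguments.
Unset Strict Implicit.
Context (q : nat) (T : homogeneousTree q).
Implicit Types (x y z o : T) (p : seq T).
Local Notation adj := (@adj q T).
Local Notation dist := (@graph_dist q T).

Lemma dist_le o p : path adj o p -> (dist o (last o p) <= size p)%N.
Proof.
move=> op; rewrite /graph_dist; case: ex_minnP => m _; apply.
by apply/asboolP; exists p.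
Qed.

Lemma geodesic o x : exists2 p, path adj o p & last o p = x /\ size p = dist o x.
Proof.
rewrite /graph_dist; case: ex_minnP => m /asboolP[p [? ? ?]] _.
by exists p.
Qed.

Lemma dist_xx x : dist x x = 0%N.
Proof. by apply/eqP; rewrite -leqn0; apply: (@dist_le x [::]). Qed.

Lemma dist_eq0 x y : (dist x y == 0%N) = (x == y).
Proof.
apply/eqP/eqP => [|->]; last exact: dist_xx.
by have [p _ [<- <-]] := geodesic x y; case: p.
Qed.

Lemma dist_sym x y : dist x y = dist y x.
Proof.
suff h a b : (dist a b <= dist b a)%N by apply/eqP; rewrite eqn_leq !h.
have [p bp [<- <-]] := geodesic b a.
have : path adj (last b p) (rev (belast b p)).
  by rewrite rev_path (eq_path (e' := adj))// => u v; exact: adj_sym.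
move=> /dist_le; rewrite size_rev size_belast.
by case: p {bp} => [//|c p]; rewrite [belast _ _]/= rev_cons last_rcons.
Qed.

Lemma dist_adj o x y : adj x y -> (dist o y <= (dist o x).+1)%N.
Proof.
move=> xy; have [p op [opx <-]] := geodesic o x.
have := @dist_le o (rcons p y); rewrite rcons_path op opx xy size_rcons last_rcons.
exact.
Qed.

Lemma dist_parent o x m : dist o x = m.+1 -> exists2 y, adj x y & dist o y = m.
Proof.
move=> dx; have [p] := geodesic o x.
case/lastP: p => [_ [/= _]|p y]; first by rewrite dx.
rewrite rcons_path last_rcons size_rcons => /andP[op py] [yx]; subst y.
rewrite dx => -[sp]; exists (last o p); first by rewrite adj_sym.
apply/eqP; rewrite eqn_leq -{1}sp dist_le//= -ltnS -dx.
exact: dist_adj.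
Qed.

(** Each step to a parent lowers the distance by one, so the descent to [o] never gets farther from
    [o] than its start. *)
Lemma down_path o x : exists p, [/\ path adj x p, last x p = o &
  all (fun v => dist o v <= dist o x)%N (x :: p)].
Proof.
have [m] := ubnP (dist o x); elim: m x => // m IH x.
case dx: (dist o x) => [|k] km.
  exists [::]; split=> //=; last by rewrite dx.
  by apply/esym/eqP; rewrite -dist_eq0 dx.
have [y xy dy] := dist_parent dx.
have [|p [yp py /allP pk]] := IH y; first by rewrite dy.
exists (y :: p); split => //; first by rewrite /= xy.
apply/allP => v; rewrite inE => /orP[/eqP ->|/pk]; first by rewrite dx.
rewrite dy; exact: leqW.
Qed.

(** Descend from [x] to [o], then climb to [y]. Such paths are the inner arcs of the cycles that
    contradict acyclicity below. *)
Lemma ball_path o x y m : (dist o x <= m)%N -> (dist o y <= m)%N ->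
  exists p, [/\ path adj x p, last x p = y & all (fun v => dist o v <= m)%N p].
Proof.
move=> xm ym; have [p [xp px /= /andP[_ /allP pm]]] := down_path o x.
have [r [yr ry /allP rm]] := down_path o y.
(* [belast y r] omits the final [o] of the second path, since the first path already ends there. *)
exists (p ++ rev (belast y r)); split.
- rewrite cat_path xp px -ry rev_path (eq_path (e' := adj))// => u v.
  exact: adj_sym.
- case: r yr ry {rm} => [|c r] /= _; last by rewrite rev_cons last_cat last_rcons.
  by rewrite cats0 => ->.
- rewrite all_cat; apply/andP; split.
    by apply/allP => v /pm /leq_trans; apply.
  apply/allP => v; rewrite mem_rev => /mem_belast /rm /leq_trans; exact.
Qed.

(* A simple path between the two points inside the ball of radius [m] is closed
   up into a cycle by vertices outside of that ball. *)
Lemma uniq_parent o x y z : adj x y -> adj x z ->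
  (dist o y < dist o x)%N -> (dist o z < dist o x)%N -> y = z.
Proof.
case dx: (dist o x) => [//|m] xy xz ym zm; apply: contrapT => yz.
have [p [yp pz /allP pm]] := ball_path ym zm.
case/shortenP: yp pz => r yr ur rp rz.
apply: (@adj_acyclic _ T (x :: y :: r)).
  by case: r rz {yr ur rp} => //= zy; case: yz.
rewrite /ucycle /= xy rcons_path yr rz adj_sym xz/= inE negb_or.
move: ur => /= ->; rewrite andbT; apply/andP; split.
  by apply/eqP => exy; move: ym; rewrite -exy dx ltnn.
by apply/negP => /rp /pm; rewrite dx ltnn.
Qed.

(** If both ends of an edge were equally far from [o], their parents could be joined inside the next
    smaller ball, closing the edge up into a cycle. *)
Lemma adj_dist_neq o x y : adj x y -> dist o x != dist o y.
Proof.
move=> xy; apply/eqP; case dx: (dist o x) => [|m] dy.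
  move/eqP: dx; move/esym/eqP: dy; rewrite !dist_eq0 => /eqP oy /eqP ox.
  by move: xy; rewrite -ox -oy adj_irr.
have [x' xx' dx'] := dist_parent dx; have [y' yy' dy'] := dist_parent (esym dy).
have [||p [xp py /allP pm]] := @ball_path o x' y' m; rewrite ?dx' ?dy'//.
case/shortenP: xp py => r xr ur rp ry.
have out v : v \in x' :: r -> (dist o v <= m)%N.
  by rewrite inE => /orP[/eqP ->|/rp /pm //]; rewrite dx'.
apply: (@adj_acyclic _ T (y :: x :: x' :: r)) => //.
rewrite /ucycle /= adj_sym xy xx' rcons_path xr ry adj_sym yy' /=.
move: ur => /= ->; rewrite andbT inE negb_or -andbA; apply/and3P; split.
- by apply/eqP => exy; move: xy; rewrite exy adj_irr.
- by apply/negP => /out; rewrite -dy ltnn.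
- by apply/negP => /out; rewrite dx ltnn.
Qed.

(** * Neighbours, children and spheres *)

Lemma nbs_spec x : {s : seq T | [/\ uniq s, size s = q & forall y, (y \in s) = adj x y]}.
Proof.
apply: cid.
have fin : finite_set [set y | adj x y].
  by apply/finite_setP; exists q; exact: adj_regular.
exists (enum_fset (fset_set [set y | adj x y])); split.
- exact: fset_uniq.
- exact: (card_fset_set (adj_regular x)).
- move=> y; rewrite -[LHS]/(y \in fset_set _) in_fset_set//.
  by apply/idP/idP => [/set_mem|xy]//; apply/mem_set.
Qed.

Definition nbs x : seq T := sval (nbs_spec x).

Lemma nbs_uniq x : uniq (nbs x). Proof. by case: (svalP (nbs_spec x)). Qed.
Lemma size_nbs x : size (nbs x) = q. Proof. by case: (svalP (nbs_spec x)). Qed.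
Lemma mem_nbs x y : (y \in nbs x) = adj x y.
Proof. by case: (svalP (nbs_spec x)). Qed.

(** Distances of adjacent vertices differ by exactly one, and a single neighbour is closer to [o];
    all the others are therefore farther away. *)
Lemma perm_nbs o x m : dist o x = m.+1 -> exists y s,
  [/\ perm_eq (nbs x) (y :: s), dist o y = m, size s = q.-1
    & forall z, z \in s -> dist o z = m.+2].
Proof.
move=> dx; have [y xy dy] := dist_parent dx.
have yn : y \in nbs x by rewrite mem_nbs.
exists y, (rem y (nbs x)); split => //.
- exact: perm_to_rem.
- by rewrite size_rem// size_nbs.
- move=> z; rewrite mem_rem_uniq ?nbs_uniq// !inE mem_nbs => /andP[zy xz].
  have := dist_adj o xz; have := adj_dist_neq o xz; rewrite dx => ne le.
  apply/eqP; rewrite eqn_leq le/= ltnNge; apply/negP => zm.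
  move/eqP: zy; apply; apply/esym/(@uniq_parent o x); rewrite ?dx ?dy//.
  by rewrite ltn_neqAle eq_sym ne.
Qed.

Lemma nbs_root o z : z \in nbs o -> dist o z = 1%N.
Proof.
rewrite mem_nbs => oz; have := dist_adj o oz; have := adj_dist_neq o oz.
by rewrite dist_xx; case: (dist o z) => [|[]].
Qed.

Definition children o x := [seq y <- nbs x | dist o y == (dist o x).+1].

Lemma mem_children o x y : (y \in children o x) = adj x y && (dist o y == (dist o x).+1).
Proof. by rewrite mem_filter mem_nbs andbC. Qed.

Lemma size_children o x : x != o -> size (children o x) = q.-1.
Proof.
rewrite eq_sym -dist_eq0; case dx: (dist o x) => [//|m] _.
have [y [s [/(perm_filter (fun y => dist o y == (dist o x).+1)) /perm_size]]] :=
  perm_nbs dx.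
rewrite /children => -> /= dy <- sm; rewrite dy dx (ltn_eqF (ltnW (leqnn _))).
rewrite -[in RHS](@all_filterP _ (fun y => dist o y == m.+2) s _) ?dx//.
by apply/allP => z /sm ->.
Qed.

Lemma children_root o : children o o = nbs o.
Proof.
by apply/all_filterP/allP => z /nbs_root ->; rewrite dist_xx.
Qed.

Fixpoint sphere o n : seq T :=
  if n is m.+1 then [seq y | x <- sphere o m, y <- children o x] else [:: o].

Lemma mem_sphere o n x : (x \in sphere o n) = (dist o x == n).
Proof.
elim: n x => [|n IH] x /=; first by rewrite inE dist_eq0 eq_sym.
apply/allpairsPdep/eqP => [[y [z [+ + ->]]]|dx].
  by rewrite IH mem_children => /eqP <- /andP[_ /eqP].
have [y xy dy] := dist_parent dx.
by exists y, x; split => //; rewrite ?IH ?mem_children ?dy ?dx ?eqxx// adj_sym xy.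
Qed.

Lemma sphere_uniq o n : uniq (sphere o n).
Proof.
elim: n => [//|n IH] /=; apply: allpairs_uniq_dep => //.
  by move=> x _; rewrite filter_uniq ?nbs_uniq.
move=> _ _ /allpairsPdep[x [y [xn + ->]]] /allpairsPdep[x' [y' [xn' + ->]]] /=.
rewrite !mem_children => /andP[xy /eqP dy] /andP[xy' /eqP dy'] yy'.
move: dy' xy'; rewrite -yy' => dy' xy'.
suff -> : x = x' by [].
apply: (@uniq_parent o y).
- by rewrite adj_sym.
- by rewrite adj_sym.
- by rewrite dy.
- by rewrite dy'.
Qed.

Lemma size_sphereS o n : size (sphere o n.+1) = (q * q.-1 ^ n)%N.
Proof.
elim: n => [|n IH].
  by rewrite /= cats0 map_id children_root size_nbs muln1.
rewrite [sphere _ _]/= -/(sphere o n.+1) size_allpairs_dep.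
have -> : [seq size (children o x) | x <- sphere o n.+1] =
    nseq (size (sphere o n.+1)) q.-1.
  rewrite -(size_map (fun x => size (children o x))); apply/all_pred1P/allP.
  move=> _ /mapP[x + ->]; rewrite mem_sphere => /eqP dx; apply/eqP.
  by apply: size_children; rewrite eq_sym -dist_eq0 dx.
by rewrite sumn_nseq IH expnS mulnCA.
Qed.

(** * Parents, ancestors and descendants *)

Definition parent o x := head x [seq y <- nbs x | dist o y < dist o x]%N.

Lemma parentE o x y : adj x y -> dist o x = (dist o y).+1 -> parent o x = y.
Proof.
move=> xy dx; have : y \in [seq y <- nbs x | dist o y < dist o x]%N.
  by rewrite mem_filter mem_nbs dx leqnn.
rewrite /parent; case E: [seq y <- _ | _]%N => [//|z r] _ /=.
have : z \in [seq y <- nbs x | dist o y < dist o x]%N by rewrite E mem_head.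
rewrite mem_filter mem_nbs => /andP[zx xz].
by apply: (@uniq_parent o x); rewrite // dx.
Qed.

(* The ancestor of [x] at level [s]; it is [x] if [dist o x <= s]. *)
Definition ancestor o s x := iter (dist o x - s) (parent o) x.

Lemma ancestor_up o s x y : adj x y -> (s <= dist o x)%N ->
  dist o y = (dist o x).+1 -> ancestor o s y = ancestor o s x.
Proof.
move=> xy sx dy; rewrite /ancestor dy subSn// iterSr (@parentE _ y x)//.
by rewrite adj_sym.
Qed.

Lemma ancestor_adj o s x y : adj x y -> (s <= dist o x)%N ->
  (s <= dist o y)%N -> ancestor o s y = ancestor o s x.
Proof.
move=> xy sx sy; have yx : adj y x by rewrite adj_sym.
have := dist_adj o xy; have := dist_adj o yx; have := adj_dist_neq o xy.
case: (ltngtP (dist o x) (dist o y)) => // lt _ h1 h2.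
- by apply: ancestor_up => //; apply/eqP; rewrite eqn_leq h2.
- by apply/esym/ancestor_up => //; apply/eqP; rewrite eqn_leq h1.
Qed.

(** An edge between levels at least [s] preserves the ancestor at level [s], and a path this short
    cannot reach a level below [s]. *)
Lemma ancestor_path o s x p : path adj x p -> (s + size p <= dist o x)%N ->
  ancestor o s (last x p) = ancestor o s x.
Proof.
elim: p x => [//|y p IH] x /= /andP[xy yp] sx.
have yx : adj y x by rewrite adj_sym.
have sy : (s + size p <= dist o y)%N.
  by rewrite -ltnS (leq_trans _ (dist_adj o yx))// -addnS.
rewrite IH//; apply: ancestor_adj => //.
- by rewrite (leq_trans _ sx)// leq_addr.
- by rewrite (leq_trans _ sy)// leq_addr.
Qed.

(** A geodesic of length at most [D] would preserve the ancestor. This is what keeps the chosen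
    target vertices apart. *)
Lemma dist_ancestor_neq o s D x y : dist o x = (s + D)%N ->
  ancestor o s x != ancestor o s y -> (D < dist x y)%N.
Proof.
move=> dx; apply: contra_neqT; rewrite -leqNgt => xyD.
have [p xp [py sp]] := geodesic x y; rewrite -py; apply/esym/ancestor_path => //.
by rewrite dx sp leq_add2l.
Qed.

Lemma exists_descendant o s D x : (1 < q)%N -> dist o x = s ->
  exists z, dist o z = (s + D)%N /\ ancestor o s z = x.
Proof.
move=> q1 dx; elim: D => [|D [y [dy ay]]].
  by exists x; rewrite addn0 /ancestor dx subnn.
have : (0 < size (children o y))%N.
  have [->|/size_children ->] := eqVneq y o; last by case: q q1 => [|[]].
  by rewrite children_root size_nbs ltnW.
case E: (children o y) => [//|z c] _.
have : z \in children o y by rewrite E mem_head.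
rewrite mem_children => /andP[yz /eqP dz]; exists z; rewrite dz dy addnS.
by split => //; rewrite -ay; apply: ancestor_up => //; rewrite dy leq_addr.
Qed.

(** With $b = q - 1 \ge 2$, adding a sphere of size $q b^n$ to a ball of size at most $q b^n$ gives
    at most $2 q b^n \le q b^{n+1}$. *)
Lemma size_ball_le o n : (2 < q)%N ->
  (size (flatten [seq sphere o k | k <- iota 0 n.+1]) <= q * q.-1 ^ n)%N.
Proof.
move=> q2; elim: n => [|n IH].
  by rewrite /= muln1 (ltn_trans _ q2).
rewrite -[n.+2]addn1 iotaD (cats1 _ n.+1) map_rcons flatten_rcons size_cat.
rewrite size_sphereS (leq_trans (leq_add IH (leqnn _)))// addnn -mul2n mulnCA.
by rewrite leq_mul2l expnS leq_mul2r -ltnS prednK ?q2 ?orbT// (ltn_trans _ q2).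
Qed.

Lemma mem_ball o n x :
  (x \in flatten [seq sphere o k | k <- iota 0 n.+1]) = (dist o x <= n)%N.
Proof.
apply/flatten_mapP/idP => [[k]|xn].
  by rewrite mem_iota mem_sphere => /andP[_ kn] /eqP ->.
by exists (dist o x); rewrite ?mem_iota ?mem_sphere.
Qed.

Lemma ball_volume_le (R : realType) o n : (2 < q)%N ->
  (ball_volume R o n <= q * q.-1 ^ n)%N.
Proof.
move=> q2; apply: leq_trans (size_ball_le o n q2).
have ballE : tree_ball o (n%:R : R) =
    [set` flatten [seq sphere o k | k <- iota 0 n.+1]].
  by apply/seteqP; split => x /=; rewrite /tree_ball/= ler_nat mem_ball.
rewrite /ball_volume ballE; apply: uniq_leq_size; first exact: fset_uniq.
move=> x; rewrite in_fset_set; last first.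
  by apply/finite_seqP; eexists.
by move=> /set_mem.
Qed.

End TreeMetric.

(** * Probabilities of events *)

Section RealProbability.
Set Implicit Arguments.
Unset Strict Implicit.
Context d (Omega : measurableType d) (R : realType) (P : probability Omega R).
Implicit Types A B : set Omega.

(** Real values make field arithmetic available; on measurable sets [fine] loses nothing, by
    [prE]. *)
Definition prob A : R := fine (P A).
Local Notation pr := prob.

Lemma prE A : measurable A -> P A = (pr A)%:E.
Proof. by move=> mA; rewrite fineK// fin_num_measure. Qed.

Lemma pr_ge0 A : 0 <= pr A.
Proof. by rewrite fine_ge0. Qed.

Lemma pr_le A B : measurable A -> measurable B -> A `<=` B -> pr A <= pr B.
Proof.
by move=> mA mB AB; rewrite -lee_fin -!prE// le_measure// inE.
Qed.

Lemma pr_setT : pr setT = 1.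
Proof. by rewrite /prob probability_setT. Qed.

Lemma pr_le1 A : measurable A -> pr A <= 1.
Proof. by move=> mA; rewrite -pr_setT pr_le. Qed.

Lemma pr_set0 : pr set0 = 0.
Proof. by rewrite /prob measure0. Qed.

Lemma prU A B : measurable A -> measurable B -> A `&` B = set0 ->
  pr (A `|` B) = pr A + pr B.
Proof.
move=> mA mB AB; apply/EFin_inj; rewrite EFinD -!prE ?measureU//.
exact: measurableU.
Qed.

Lemma prID A B : measurable A -> measurable B ->
  pr A = pr (A `&` B) + pr (A `&` ~` B).
Proof.
move=> mA mB; rewrite -prU.
- by rewrite -setIUr setUv setIT.
- exact: measurableI.
- by apply: measurableI => //; exact: measurableC.
- by rewrite setIACA setICr setI0.
Qed.

Lemma prC A : measurable A -> pr (~` A) = 1 - pr A.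
Proof.
by move=> mA; rewrite -pr_setT (prID measurableT mA) !setTI addrC addKr.
Qed.

(** Continuity from below: it carries bounds uniform in the time horizon over to the whole
    trajectory. *)
Lemma pr_bigcup_le (F : nat -> set Omega) c : (forall m, measurable (F m)) ->
  nondecreasing_seq F -> (forall m, pr (F m) <= c) -> pr (\bigcup_m F m) <= c.
Proof.
move=> mF ndF Fc; have mU : measurable (\bigcup_m F m) by exact: bigcupT_measurable.
rewrite -lee_fin -prE//.
apply: (cvge_to_le (nondecreasing_cvg_mu (mu := P) mF mU ndF)).
by apply: nearW => m /=; rewrite prE// lee_fin.
Qed.

(** Both claims go through one induction, because additivity at each step uses measurability of the
    remaining union. *)
Lemma pr_partition (V : choiceType) (Y : Omega -> V) A (s : seq V) :
  (forall y, measurable (Y @^-1` [set y])) -> measurable A -> uniq s ->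
  measurable [set w | Y w \in s] /\
  pr (A `&` [set w | Y w \in s]) = \sum_(y <- s) pr (A `&` Y @^-1` [set y]).
Proof.
move=> mY mA; elim: s => [_|y s IH /= /andP[ys us]].
  have -> : [set w | Y w \in [::]] = set0 by apply/seteqP; split.
  by rewrite setI0 pr_set0 big_nil.
have [ms es] := IH us.
have E : [set w | Y w \in y :: s] = Y @^-1` [set y] `|` [set w | Y w \in s].
  apply/seteqP; split => w /=; rewrite inE.
    by case/orP => [/eqP|]; [left|right].
  by case=> [->|->]; rewrite ?eqxx ?orbT.
split; first by rewrite E; exact: measurableU.
rewrite E big_cons -es setIUr prU//; [exact: measurableI|exact: measurableI|].
apply/seteqP; split => // w /= [[_ Yw] [_]].
by rewrite Yw (negbTE ys).
Qed.

(* Integrating [1_{N = 0} + 2 a N <= 1 + a^2 N^2], where [N] counts the events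
   that occur, at [a = 1 / E N]. *)
Lemma second_moment (I : eqType) (s : seq I) (U : I -> set Omega) :
  (forall i, measurable (U i)) -> 0 < \sum_(i <- s) pr (U i) ->
  pr (\bigcap_(i in [set` s]) ~` U i) <=
  (\sum_(i <- s) \sum_(j <- s) pr (U i `&` U j)) /
    (\sum_(i <- s) pr (U i)) ^+ 2 - 1.
Proof.
move=> mU; set m := \sum_(i <- s) pr (U i); set v := \sum_(i <- s) _ => m0.
set Z := \bigcap_(i in _) _.
have mZ : measurable Z.
  apply: fin_bigcap_measurable; first by apply/finite_seqP; exists s.
  by move=> i _; exact: measurableC.
have key a : 0 <= a -> pr Z + 2 * a * m <= 1 + a ^+ 2 * v.
  move=> a0.
  have mind (A : set Omega) : measurable A -> measurable_fun [set: Omega] (fun w => (\1_A w : R)%:E : \bar R).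
    by move=> mA; apply/measurable_EFinP; exact: measurable_indic.
  have ind0 (A : set Omega) w : (0 <= (\1_A w : R)%:E)%E by rewrite lee_fin.
  have iE A : measurable A -> (\int[P]_w (\1_A w : R)%:E = (pr A)%:E)%E.
    by move=> mA; rewrite integral_indic// setIT; exact: prE.
  have sE (J : Type) (r : seq J) (A : J -> set Omega) : (forall j, measurable (A j)) ->
      (\int[P]_w (\sum_(j <- r) (\1_(A j) w : R)%:E) = (\sum_(j <- r) pr (A j))%:E)%E.
    move=> mA; rewrite ge0_integral_sum//; last by move=> j; exact: mind.
    by rewrite -sumEFin; apply: eq_bigr => j _; exact: iE.
  have msum (J : Type) (r : seq J) (A : J -> set Omega) : (forall j, measurable (A j)) ->
      measurable_fun [set: Omega] (fun w => (\sum_(j <- r) (\1_(A j) w : R)%:E)%E : \bar R).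
    by move=> mA; apply: emeasurable_sum => j; exact: mind.
  have sum0 (J : Type) (r : seq J) (A : J -> set Omega) w :
      (0 <= \sum_(j <- r) (\1_(A j) w : R)%:E)%E by exact: sume_ge0.
  (* Indexing by pairs turns the double sum into a single one, to which [sE] applies. *)
  pose W (ij : I * I) := U ij.1 `&` U ij.2.
  have mW ij : measurable (W ij) by exact: measurableI.
  pose ss := [seq (i, j) | i <- s, j <- s].
  have vE : v = \sum_(ij <- ss) pr (W ij).
    by rewrite big_allpairs.
  have h : (\int[P]_w ((\1_Z w : R)%:E + (2 * a)%:E * \sum_(i <- s) (\1_(U i) w : R)%:E) <=
      \int[P]_w ((\1_setT w : R)%:E + (a ^+ 2)%:E * \sum_(ij <- ss) (\1_(W ij) w : R)%:E))%E.
    have a20 : 0 <= 2 * a by rewrite mulr_ge0.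
    apply: ge0_le_integral => //.
    - by move=> w _; rewrite adde_ge0// mule_ge0.
    - apply: emeasurable_funD; [exact: mind|].
      by apply: measurable_funeM; exact: msum.
    - by apply: emeasurable_funD; [exact: mind|apply: measurable_funeM; exact: msum].
    move=> w _; rewrite !sumEFin -!EFinM -!EFinD lee_fin indicT.
    have -> : \sum_(ij <- ss) (\1_(W ij) w : R) = (\sum_(i <- s) \1_(U i) w) ^+ 2.
      rewrite big_allpairs/= expr2 mulr_suml; apply: eq_bigr => i _.
      by rewrite mulr_sumr; apply: eq_bigr => j _; rewrite /W indicI.
    set N := \sum_(i <- s) _.
    (* Off [Z] the two sides differ by the square $(1 - a N)^2$; on [Z] the count [N] vanishes and
       both sides are 1. *)
    have [wZ|wZ] := boolP (w \in Z); last first.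
      rewrite indicE (negbTE wZ) add0r -subr_ge0.
      by rewrite (_ : _ - _ = (1 - a * N) ^+ 2) ?sqr_ge0// /cst; ring.
    suff -> : N = 0 by rewrite indicE wZ expr0n !mulr0 !addr0.
    rewrite /N big_seq big1// => i si; rewrite indicE memNset//.
    by move/set_mem: wZ => /(_ i); exact.
  move: h; rewrite !ge0_integralD//.
  - rewrite !ge0_integralZl//.
    + rewrite iE// iE// pr_setT !sE// -!EFinM -!EFinD lee_fin -vE; exact.
    + exact: msum.
    + by rewrite lee_fin sqr_ge0.
    + exact: msum.
    + by rewrite lee_fin mulr_ge0.
  - exact: mind.
  - by move=> w _; rewrite mule_ge0// lee_fin sqr_ge0.
  - by apply: measurable_funeM; exact: msum.
  - exact: mind.
  - by move=> w _; rewrite mule_ge0// lee_fin mulr_ge0.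
  - by apply: measurable_funeM; exact: msum.
have := key m^-1; rewrite invr_ge0 (ltW m0) => /(_ isT).
rewrite -mulrA mulVf ?gt_eqF// exprVn [_^-1 * v]mulrC.
by set x := v / _; lra.
Qed.

End RealProbability.

(** * Hitting probabilities of the simple random walk *)

Section Hitting.
Set Implicit Arguments.
Unset Strict Implicit.
Context (q : nat) (T : homogeneousTree q) (R : realType).
Hypothesis hq : (2 < q)%N.
Local Notation adj := (@adj q T).
Local Notation dist := (@graph_dist q T).

(* The probability of ever hitting a given neighbour. *)
Definition hitF : R := (q.-1)%:R^-1.
Local Notation beta := hitF.

Lemma hitF_ge0 : 0 <= beta. Proof. by rewrite invr_ge0. Qed.

Lemma hitF_le1 : beta <= 1.
Proof. by rewrite invf_le1 ?ler1n ?ltr0n; lia. Qed.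

(** With $b = q - 1$ and $b \beta = 1$, the parent and the $b$ children of a vertex at level $m + 1$
    contribute $\beta^m + b \beta^{m+2} = (b + 1) \beta^{m+1}$. *)
Lemma hitF_harmonic o x : x != o ->
  \sum_(y <- nbs x) beta ^+ dist o y = q%:R * beta ^+ dist o x.
Proof.
rewrite eq_sym -dist_eq0; case dx: (dist o x) => [//|m] _.
have [y [s [/(perm_big _) -> dy ss sm]]] := perm_nbs dx.
rewrite big_cons dy big_seq (eq_bigr (fun=> beta ^+ m.+2)); last first.
  by move=> z /sm ->.
rewrite -big_seq big_const_seq count_predT ss iter_addr_0.
have bE : q.-1%:R * beta = 1 :> R.
  by rewrite divff// pnatr_eq0; case: q hq => [|[]].
have -> : q%:R = q.-1%:R + 1 :> R by rewrite natr1 prednK// (ltn_trans _ hq).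
by rewrite /= -[_ *+ q.-1]mulr_natl !exprS mulrDl ![q.-1%:R * (beta * _)]mulrA bE !mul1r.
Qed.

Context d (Omega : measurableType d) (P : probability Omega R).
Context (e : T) (X : nat -> Omega -> T).
Hypothesis hX : simple_random_walk P e X.
Local Notation pr := (prob P).

Definition prefix k (x : nat -> T) := [set w | forall i, (i <= k)%N -> X i w = x i].

Let mX k x : measurable (X k @^-1` [set x]). Proof. by case: hX. Qed.

Lemma measurable_prefix k x : measurable (prefix k x).
Proof.
have -> : prefix k x = \bigcap_(i in [set i | (i <= k)%N]) X i @^-1` [set x i].
  by apply/seteqP; split.
by apply: bigcap_measurableType.
Qed.

(** The bounded horizon allows induction: one step of the walk trades [m.+1] steps left at time [k]
    for [m] steps left at time [k.+1]. *)
Definition within z k m := [set w | exists2 j, (j <= m)%N & X (k + j) w = z].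

Lemma measurable_within z k m : measurable (within z k m).
Proof.
have -> : within z k m = \bigcup_(j in [set j | (j <= m)%N]) X (k + j) @^-1` [set z].
  by apply/seteqP; split.
by apply: bigcup_measurable.
Qed.

Lemma prefix_step k x y : adj (x k) y ->
  pr (prefix k x `&` X k.+1 @^-1` [set y]) = pr (prefix k x) / q%:R.
Proof.
move=> xy; pose x' i := if i == k.+1 then y else x i.
have x'E i : (i <= k)%N -> x' i = x i by rewrite /x'; case: eqP => // ->; rewrite ltnn.
have eqk : prefix k x' = prefix k x.
  by apply/seteqP; split => w h i ik; have := h i ik; rewrite x'E.
have eqk1 : prefix k.+1 x' = prefix k x `&` X k.+1 @^-1` [set y].
  apply/seteqP; split => w /=.
    move=> h; split; last by rewrite h// /x' eqxx.
    by move=> i ik; rewrite h ?x'E// leqW.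
  move=> [h hy] i; rewrite leq_eqVlt ltnS => /orP[/eqP ->|ik].
    by rewrite /x' eqxx.
  by rewrite h// x'E.
case: hX => _ _ /(_ k x'); rewrite -/(prefix k.+1 x') -/(prefix k x') eqk eqk1.
rewrite /srw_kernel x'E// {1}/x' eqxx xy /prob => ->.
by rewrite fineM// fin_num_measure//; exact: measurable_prefix.
Qed.

(** The [q] neighbours each receive a fraction $1/q$ of the mass of the history, which leaves
    nothing for other vertices. *)
Lemma prefix_nbs k x : measurable [set w | X k.+1 w \in nbs (x k)] /\
  pr (prefix k x `&` ~` [set w | X k.+1 w \in nbs (x k)]) = 0.
Proof.
have [mN eN] := pr_partition P (mX k.+1) (measurable_prefix k x) (nbs_uniq (x k)).
split => //; have := prID P (measurable_prefix k x) mN; rewrite eN.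
rewrite big_seq (eq_bigr (fun=> pr (prefix k x) / q%:R)); last first.
  by move=> y; rewrite mem_nbs; exact: prefix_step.
rewrite -big_seq big_const_seq count_predT size_nbs iter_addr_0.
have q0 : q%:R != 0 :> R by rewrite pnatr_eq0; case: q hq.
by rewrite -[(_ / _) *+ q]mulr_natr divfK// -[X in X = _]addr0 => /addrI.
Qed.

(** A supermartingale bound on cylinder events, by induction on the number [m] of steps left, for
    all times and histories at once. On [F] the bound is assumed; off [F] the event passes to the
    next time and [G] is superharmonic. *)
Lemma optional_stopping (F : pred T) (G : T -> R) (E : nat -> nat -> set Omega) :
  (forall k m, measurable (E k m)) -> (forall x, 0 <= G x) ->
  (forall x, ~~ F x -> \sum_(y <- nbs x) G y <= q%:R * G x) ->
  (forall k m x, F (x k) ->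
     pr (prefix k x `&` E k m) <= pr (prefix k x) * G (x k)) ->
  (forall k w, ~~ F (X k w) -> ~ E k 0%N w) ->
  (forall k m w, ~~ F (X k w) -> E k m.+1 w -> E k.+1 m w) ->
  forall m k x, pr (prefix k x `&` E k m) <= pr (prefix k x) * G (x k).
Proof.
move=> mE G0 Gsup GF E0 ES.
elim=> [|m IH] k x; have [Fx|Fx] := boolP (F (x k)); try exact: GF.
  rewrite (_ : _ `&` _ = set0) ?pr_set0 ?mulr_ge0 ?pr_ge0//.
  by apply/seteqP; split => // w [/(_ k (leqnn k)) wx]; apply: E0; rewrite wx.
have mp := measurable_prefix k x.
have mC : measurable (prefix k x `&` E k m.+1) by exact: measurableI.
have [mN N0] := prefix_nbs k x.
rewrite (prID P mC mN).
have -> : pr (prefix k x `&` E k m.+1 `&` ~` [set w | X k.+1 w \in nbs (x k)]) = 0.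
  apply/eqP; rewrite eq_le pr_ge0 andbT -N0; apply: pr_le.
  - by apply: measurableI => //; exact: measurableC.
  - by apply: measurableI => //; exact: measurableC.
  - by move=> w [[? _] ?].
rewrite addr0 (pr_partition P (mX k.+1) mC (nbs_uniq (x k))).2.
have q0 : 0 < q%:R :> R by rewrite ltr0n; case: q hq.
(* The history extended by a neighbour [y] has mass divided by [q] and obeys the bound with one step
   less. *)
apply: (@le_trans _ _ (\sum_(y <- nbs (x k)) pr (prefix k x) / q%:R * G y)).
  rewrite big_seq [leRHS]big_seq; apply: ler_sum => y; rewrite mem_nbs => xy.
  pose x' i := if i == k.+1 then y else x i.
  have eqk1 : prefix k.+1 x' = prefix k x `&` X k.+1 @^-1` [set y].
    apply/seteqP; split => w /=.
      move=> h; split; last by rewrite h// /x' eqxx.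
      by move=> i ik; rewrite h ?leqW// /x' ltn_eqF.
    move=> [h hy] i; rewrite leq_eqVlt ltnS => /orP[/eqP ->|ik].
      by rewrite /x' eqxx.
    by rewrite h// /x' ltn_eqF.
  have := IH k.+1 x'; rewrite eqk1 prefix_step// {1}/x' eqxx; apply: le_trans.
  apply: pr_le; try by do ?apply: measurableI.
  move=> w [[wx wE] wy]; split => //; apply: ES => //.
  by rewrite (wx k).
rewrite -mulr_sumr -mulrA ler_wpM2l ?pr_ge0// mulrC ler_pdivrMr// mulrC.
exact: Gsup.
Qed.

Lemma within_step z k m w : X k w != z -> within z k m.+1 w -> within z k.+1 m w.
Proof.
move=> Xz [[|j] jm]; first by rewrite addn0 => /eqP; rewrite (negbTE Xz).
by rewrite addnS -addSn; exists j.
Qed.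

Lemma within0 z k w : X k w != z -> ~ within z k 0 w.
Proof.
by move=> + [[|//] _]; rewrite addn0 => /eqP.
Qed.

(** The function $\beta^{d(z, \cdot)}$ is harmonic off [z] and equals 1 at [z]. *)
Lemma pr_prefix_within z m k x :
  pr (prefix k x `&` within z k m) <= pr (prefix k x) * beta ^+ dist z (x k).
Proof.
apply: (@optional_stopping (pred1 z) (fun x => beta ^+ dist z x) (within z)).
- exact: measurable_within.
- by move=> y; rewrite exprn_ge0// hitF_ge0.
- by move=> y yz; rewrite hitF_harmonic.
- move=> {m}k m {}x /eqP ->; rewrite dist_xx mulr1; apply: pr_le.
  + by apply: measurableI; [exact: measurable_prefix|exact: measurable_within].
  + exact: measurable_prefix.
  + exact: subIsetl.
- by move=> {}k w; exact: within0.
- by move=> {m}k m w; exact: within_step.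
Qed.

(* The bound at [x] splits according to which of [z] and [z'] is hit first. *)
Lemma pr_prefix_within2 z z' m k x :
  pr (prefix k x `&` (within z k m `&` within z' k m)) <= pr (prefix k x) *
    ((beta ^+ dist z (x k) + beta ^+ dist z' (x k)) * beta ^+ dist z z').
Proof.
have b0 n : 0 <= beta ^+ n by rewrite exprn_ge0// hitF_ge0.
apply: (@optional_stopping [pred v | (v == z) || (v == z')]
  (fun v => (beta ^+ dist z v + beta ^+ dist z' v) * beta ^+ dist z z')
  (fun k m => within z k m `&` within z' k m)).
- by move=> *; apply: measurableI; exact: measurable_within.
- by move=> y; rewrite mulr_ge0// addr_ge0.
- move=> y; rewrite negb_or => /andP[yz yz'].
  by rewrite -mulr_suml big_split/= !hitF_harmonic// -mulrDr mulrA.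
- move=> {m}k m {}x Fx.
  have mp := measurable_prefix k x; have mw v := measurable_within v k m.
  (* At one of the two vertices only the other remains to be hit; the summand with exponent zero
     already covers that probability. *)
  case/orP: Fx => /eqP xE.
  + apply: (@le_trans _ _ (pr (prefix k x `&` within z' k m))).
      apply: pr_le; [|exact: measurableI|by move=> w [? []]].
      by apply: measurableI => //; exact: measurableI.
    apply: le_trans (pr_prefix_within _ _ _ _) _.
    rewrite ler_wpM2l ?pr_ge0// xE dist_xx [dist z' z]dist_sym ler_peMl//.
    by rewrite lerDl.
  + apply: (@le_trans _ _ (pr (prefix k x `&` within z k m))).
      apply: pr_le; [|exact: measurableI|by move=> w [? []]].
      by apply: measurableI => //; exact: measurableI.
    apply: le_trans (pr_prefix_within _ _ _ _) _.
    by rewrite ler_wpM2l ?pr_ge0// xE dist_xx ler_peMl// lerDr.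
- move=> {}k w; rewrite negb_or => /andP[wz _] [h _]; exact: (within0 wz h).
- move=> {m}k m w; rewrite negb_or => /andP[wz wz'] [h h'].
  by split; exact: within_step.
Qed.

Definition hits z := [set w | exists k, X k w = z].

Lemma hitsE z : hits z = \bigcup_m within z 0 m.
Proof.
apply/seteqP; split => w /= [k]; first by exists k => //; exists k.
by move=> _ [j _ wz]; exists j; rewrite -wz add0n.
Qed.

Lemma within_nd z k : nondecreasing_seq (within z k).
Proof.
move=> m n mn; apply/subsetPset => w [j jm wz]; exists j => //.
exact: leq_trans mn.
Qed.

Lemma measurable_hits z : measurable (hits z).
Proof. by rewrite hitsE; apply: bigcupT_measurable => m; exact: measurable_within. Qed.

(** The start at [e] is almost sure, so the bounds on histories apply with the trivial history at
    time 0. *)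
Let pr_start A : measurable A -> pr A = pr (prefix 0 (fun=> e) `&` A).
Proof.
move=> mA; have mp := measurable_prefix 0 (fun=> e).
rewrite (prID P mA mp) setIC -[RHS]addr0; congr (_ + _).
apply/eqP; rewrite eq_le pr_ge0 andbT.
apply: (@le_trans _ _ (pr (~` prefix 0 (fun=> e)))).
  apply: pr_le; last exact: subIsetr.
  - by apply: measurableI => //; exact: measurableC.
  - exact: measurableC.
rewrite prC// (_ : prefix 0 _ = X 0%N @^-1` [set e]); last first.
  apply/seteqP; split => w /=; first by move/(_ 0%N); exact.
  by move=> we i; rewrite leqn0 => /eqP ->.
by case: hX => _ + _; rewrite /prob => ->; rewrite subrr.
Qed.

Lemma pr_hits_le z : pr (hits z) <= beta ^+ dist z e.
Proof.
rewrite hitsE; apply: pr_bigcup_le; [exact: measurable_within|exact: within_nd|].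
move=> m; rewrite pr_start; last exact: measurable_within.
apply: le_trans (pr_prefix_within _ _ _ _) _.
rewrite ler_piMl ?exprn_ge0 ?hitF_ge0// pr_le1//; exact: measurable_prefix.
Qed.

Lemma pr_hits2_le z z' : pr (hits z `&` hits z') <=
  (beta ^+ dist z e + beta ^+ dist z' e) * beta ^+ dist z z'.
Proof.
have -> : hits z `&` hits z' = \bigcup_m (within z 0 m `&` within z' 0 m).
  rewrite !hitsE; apply/seteqP; split => w.
    move=> [[m _ wz] [m' _ wz']]; exists (maxn m m') => //; split.
    - by have /subsetPset := within_nd z 0 (leq_maxl m m'); exact.
    - by have /subsetPset := within_nd z' 0 (leq_maxr m m'); exact.
  by move=> [m _ [wz wz']]; split; exists m.
apply: pr_bigcup_le.
- by move=> m; apply: measurableI; exact: measurable_within.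
- move=> m n mn; apply/subsetPset; apply: setISS; apply/subsetPset; exact: within_nd.
move=> m; rewrite pr_start; last by apply: measurableI; exact: measurable_within.
apply: le_trans (pr_prefix_within2 _ _ _ _ _) _.
rewrite ler_piMl ?mulr_ge0 ?addr_ge0 ?exprn_ge0 ?hitF_ge0//.
rewrite pr_le1//; exact: measurable_prefix.
Qed.

(** Independence is stated for events of the sigma-algebras of the walks, so mere measurability of
    [hits z] would not suffice. *)
Lemma hits_process_sigma z : process_sigma X (hits z).
Proof.
have -> : hits z = \bigcup_k X k @^-1` [set z].
  by apply/seteqP; split => w [k]; exists k.
have [_ _ cl] : sigma_algebra setT (process_sigma X) by exact: smallest_sigma_algebra.
by apply: cl => k; apply: sub_sigma_algebra; exists k, z.
Qed.

Lemma process_sigma_measurable A : process_sigma X A -> measurable A.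
Proof.
apply: smallest_sub; first exact: sigma_algebra_measurable.
by move=> _ [k [x ->]]; exact: mX.
Qed.

End Hitting.

(** * Missed vertices *)

Section Events.
Set Implicit Arguments.
Unset Strict Implicit.
Context d (Omega : measurableType d) (R : realType) (P : probability Omega R).
Local Notation pr := (prob P).

(** Let $m$ be the sum of the probabilities. In the second moment the diagonal contributes $m$ and
    the remaining terms at most $\rho m^2$; divide by $m^2$. *)
Lemma quasi_independent_union (I : eqType) (s : seq I) (U : I -> set Omega) rho :
  uniq s -> (forall i, measurable (U i)) -> 0 < \sum_(i <- s) pr (U i) -> 0 <= rho ->
  (forall i j, i \in s -> j \in s -> i != j ->
     pr (U i `&` U j) <= rho * (pr (U i) * pr (U j))) ->
  pr (\bigcap_(i in [set` s]) ~` U i) <= (\sum_(i <- s) pr (U i))^-1 + rho - 1.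
Proof.
move=> us mU m0 rho0 hU; apply: le_trans (second_moment mU m0) _.
set m := \sum_(i <- s) pr (U i) in m0 *.
rewrite lerD2r ler_pdivrMr ?exprn_gt0// mulrDl expr2 mulrA mulVf ?gt_eqF// mul1r.
rewrite mulrA -[rho * m * m]mulrA {1}/m !mulr_suml !mulr_sumr -big_split/=.
rewrite big_seq [leRHS]big_seq; apply: ler_sum => i si.
rewrite (bigD1_seq i)//= setIid lerD2l {1}/m mulr_sumr mulr_sumr.
rewrite [leRHS](bigD1_seq i)//= -[leLHS]add0r lerD//.
  by rewrite !mulr_ge0 ?pr_ge0.
rewrite big_seq_cond [leRHS]big_seq_cond; apply: ler_sum => j /andP[sj ji].
by apply: hU; rewrite // eq_sym.
Qed.

(** The probability of the limsup is the limit of those of the tail unions, and each tail union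
    contains events of probability arbitrarily close to 1. *)
Lemma lim_sup_set_eq1 (E : nat -> set Omega) : (forall n, measurable (E n)) ->
  (forall j eps, 0 < eps -> exists2 n, (j <= n)%N & 1 - eps <= pr (E n)) ->
  P (lim_sup_set E) = 1%E.
Proof.
move=> mE hE.
have mU n : measurable (\bigcup_(k >= n) E k) by exact: bigcup_measurable.
have mL : measurable (lim_sup_set E) by apply: bigcap_measurableType.
apply/eqP; rewrite eq_le probability_le1//=.
apply: (cvge_to_ge (lim_sup_set_cvg P E mE _)).
  by rewrite ltey_eq fin_num_measure//.
apply: nearW => j; rewrite [leRHS](prE P (mU j)) lee_fin; apply/ler_addgt0Pr => eps eps0.
have [n jn hn] := hE j eps eps0; rewrite -lerBlDr (le_trans hn)//.
by apply: pr_le => // w Ew; exists n.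
Qed.

End Events.

(** * Vertices missed by the first walks, and the cluster *)

Section Unhit.
Set Implicit Arguments.
Unset Strict Implicit.
Context (q : nat) (T : homogeneousTree q) (R : realType) (e : T).
Context d (Omega : measurableType d) (P : probability Omega R).
Context (S : nat -> nat -> Omega -> T).
Hypothesis hsrw : forall n : nat, (1 <= n)%N -> simple_random_walk P e (S n).
Hypothesis hind : independent_processes P (fun n : nat => S n.+1).
Hypothesis hq : (2 < q)%N.
Local Notation pr := (prob P).
Local Notation dist := (@graph_dist q T).
Local Notation beta := (hitF q R).

Lemma pr_indep N (E : nat -> set Omega) :
  (forall i, process_sigma (S i.+1) (E i)) ->
  pr (\bigcap_(i in [set` iota 0 N]) E i) = \prod_(i <- iota 0 N) pr (E i).
Proof.
move=> sE; have mE i : measurable (E i).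
  by apply: process_sigma_measurable (sE i); exact: hsrw.
have := hind (iota_uniq 0 N) (fun i _ => sE i); rewrite /prob => ->.
elim: (iota 0 N) => [|i s IH]; first by rewrite !big_nil.
rewrite !big_cons -IH fineM ?fin_num_measure//.
elim: s {IH} => [|j s IH]; first by rewrite big_nil.
by rewrite big_cons fin_numM// fin_num_measure.
Qed.

(** The walks are not stopped on leaving the cluster, so this event is an intersection of
    independent ones. *)
Definition unhit N z := \bigcap_(i in [set` iota 0 N]) ~` hits (S i.+1) z.

Let sigmaC i z : process_sigma (S i.+1) (~` hits (S i.+1) z).
Proof.
have [_ cl _] : sigma_algebra setT (process_sigma (S i.+1)).
  exact: smallest_sigma_algebra.
by rewrite -setTD; apply: cl; exact: hits_process_sigma.
Qed.

Let sigmaC2 i z z' :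
  process_sigma (S i.+1) (~` hits (S i.+1) z `&` ~` hits (S i.+1) z').
Proof.
have [_ cl clU] : sigma_algebra setT (process_sigma (S i.+1)).
  exact: smallest_sigma_algebra.
(* [bigcup2] continues the pair by empty sets, whence the third goal. *)
rewrite -setCU -setTD; apply: cl; rewrite -bigcup2E; apply: clU => -[|[|k]] /=.
- exact: hits_process_sigma.
- exact: hits_process_sigma.
- by case: (smallest_sigma_algebra setT [set E | exists k x, E = S i.+1 k @^-1` [set x]]).
Qed.

Let mhits i z : measurable (hits (S i.+1) z).
Proof. by apply: (measurable_hits (P := P) (e := e)); exact: hsrw. Qed.

Lemma measurable_unhit N z : measurable (unhit N z).
Proof.
by apply: bigcap_measurableType => i _; apply: measurableC.
Qed.

Lemma unhitE N z : pr (unhit N z) = \prod_(i <- iota 0 N) (1 - pr (hits (S i.+1) z)).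
Proof.
by rewrite pr_indep//; apply: eq_bigr => i _; rewrite prC.
Qed.

Lemma pr_unhit_ge N z H : H <= 1 -> beta ^+ dist z e <= H -> (1 - H) ^+ N <= pr (unhit N z).
Proof.
move=> H1 hH; rewrite unhitE -{1}(size_iota 0 N); elim: (iota 0 N) => [|i s IH].
  by rewrite big_nil.
rewrite big_cons exprS ler_pM ?subr_ge0 ?exprn_ge0 ?subr_ge0//.
rewrite lerD2l lerN2 (le_trans _ hH)//.
exact: (pr_hits_le hq (hsrw (ltn0Sn i))).
Qed.

(** For one walk with hitting probabilities $a, b \le 1/2$ and joint probability $p \le \delta$,
    missing both has probability $(1-a)(1-b) + p - ab$. As $(1-a)(1-b) \ge 1/4$, this is at most $(1
    + 4\delta)(1-a)(1-b)$; multiply over the walks. *)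
Lemma pr_unhit2_le N z z' delta :
  beta ^+ dist z e <= 2^-1 -> beta ^+ dist z' e <= 2^-1 ->
  (beta ^+ dist z e + beta ^+ dist z' e) * beta ^+ dist z z' <= delta ->
  pr (unhit N z `&` unhit N z') <=
    (1 + 4 * delta) ^+ N * (pr (unhit N z) * pr (unhit N z')).
Proof.
move=> hz hz' hd.
have -> : unhit N z `&` unhit N z' =
    \bigcap_(i in [set` iota 0 N]) (~` hits (S i.+1) z `&` ~` hits (S i.+1) z').
  by rewrite /unhit -bigcapI.
rewrite pr_indep// !unhitE -{2}(size_iota 0 N); elim: (iota 0 N) => [|i s IH].
  by rewrite !big_nil !mulr1.
rewrite !big_cons exprS.
have := pr_hits_le hq (hsrw (ltn0Sn i)) z.
have := pr_hits_le hq (hsrw (ltn0Sn i)) z'.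
have := pr_hits2_le hq (hsrw (ltn0Sn i)) z z'.
move=> /le_trans /(_ hd) p2 /le_trans /(_ hz') h' /le_trans /(_ hz) h.
have E : pr (~` hits (S i.+1) z `&` ~` hits (S i.+1) z') =
    1 - pr (hits (S i.+1) z) - pr (hits (S i.+1) z') +
    pr (hits (S i.+1) z `&` hits (S i.+1) z').
  have mC := measurableC (mhits i z').
  have := prID P mC (mhits i z); rewrite prC// [~` _ `&` ~` _]setIC.
  have := prID P (mhits i z) (mhits i z'); rewrite [~` _ `&` hits _ z]setIC; lra.
apply: (@le_trans _ _ ((1 + 4 * delta) * ((1 - pr (hits (S i.+1) z)) *
   (1 - pr (hits (S i.+1) z'))) * ((1 + 4 * delta) ^+ size s *
   (\prod_(j <- s) (1 - pr (hits (S j.+1) z)) *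
   \prod_(j <- s) (1 - pr (hits (S j.+1) z')))))); last first.
  by rewrite le_eqVlt; apply/orP; left; apply/eqP; ring.
apply: ler_pM => //; first exact: pr_ge0.
  by apply: prodr_ge0 => j _; exact: pr_ge0.
rewrite E; have := pr_ge0 P (hits (S i.+1) z); have := pr_ge0 P (hits (S i.+1) z').
have := pr_ge0 P (hits (S i.+1) z `&` hits (S i.+1) z').
move: p2 h' h; set p := pr (_ `&` _); set a := pr (hits _ z); set b := pr (hits _ z').
move=> p2 hb ha p0 b0 a0; have d0 : 0 <= delta by exact: le_trans p2.
have ab4 : 2^-1 * 2^-1 <= (1 - a) * (1 - b) by apply: ler_pM => //; lra.
have : delta * (2^-1 * 2^-1) <= delta * ((1 - a) * (1 - b)) by exact: ler_wpM2l.
have : 0 <= a * b by exact: mulr_ge0.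
lra.
Qed.

(** The cluster grows only at positions of walks, so each of its points other than [e] lies on one
    of the first [N] trajectories. *)
Lemma idla_sub N w z : idla e S N w z -> z = e \/ exists2 i, (i < N)%N & hits (S i.+1) z w.
Proof.
elim: N => [//|[|N] IH /=]; first by left.
case=> [/IH[|[i iN hi]]|[k _ Sk]]; [by left|by right; exists i => //; exact: ltnW|].
by right; exists N.+1 => //; exists k.
Qed.

Lemma unhit_sub N z : z != e -> unhit N z `<=` [set w | ~ idla e S N w z].
Proof.
move=> /eqP ze w wU /idla_sub [//|[i iN hi]].
by apply: (wU i) hi => /=; rewrite mem_iota.
Qed.

Lemma countable_tree : countable [set: T].
Proof.
have -> : [set: T] = \bigcup_n [set` sphere e n].
  by apply/seteqP; split => // x _; exists (dist e x) => //=; rewrite mem_sphere.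
apply: bigcup_countable => // n _; apply: finite_set_countable.
by apply/finite_seqP; exists (sphere e n).
Qed.

(** An exit at time [k] is expressed by countable operations: at each earlier time, split according
    to the vertex [x] occupied and require [x] to lie in the previous cluster. *)
Lemma measurable_idla N z : measurable [set w | idla e S N w z].
Proof.
elim: N z => [|[|N] IH] z.
- rewrite (_ : [set _ | _] = set0)//.
- have [->|ze] := eqVneq z e; first by rewrite (_ : [set _ | _] = setT)//; apply/seteqP.
  rewrite (_ : [set _ | _] = set0)//; apply/seteqP; split => // w /= zE.
  by rewrite zE eqxx in ze.
have mS k x : measurable (S N.+2 k @^-1` [set x]).
  by have [] := hsrw (ltn0Sn N.+1).
have -> : [set w | idla e S N.+2 w z] = [set w | idla e S N.+1 w z] `|`
    \bigcup_k (S N.+2 k @^-1` [set z] `&` (~` [set w | idla e S N.+1 w z] `&`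
     \bigcap_(j in [set j | (j < k)%N]) \bigcup_x
       (S N.+2 j @^-1` [set x] `&` [set w | idla e S N.+1 w x]))).
  apply/seteqP; split => w /=.
    case=> [|[k [nk lk] wz]]; [by left|right; exists k => //; split => //].
    split; first by move=> /=; rewrite -wz.
    by move=> j jk; exists (S N.+2 j w) => //; split => //; exact: lk.
  case=> [|[k _ [wz [nk lk]]]]; [by left|right; exists k => //; split].
    by rewrite wz.
  by move=> j jk; have [x _ [-> ]] := lk j jk.
apply: measurableU; first exact: IH.
apply: bigcupT_measurable => k; apply: measurableI => //; apply: measurableI.
  by apply: measurableC; exact: IH.
apply: bigcap_measurableType => j _; apply: countable_bigcupT_measurable.
  exact: countable_tree.
by move=> x; apply: measurableI => //; exact: IH.
Qed.

Lemma measurable_uncovered N (r : R) :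
  measurable [set w | (~` idla e S N w) `&` tree_ball e r !=set0].
Proof.
have -> : [set w | (~` idla e S N w) `&` tree_ball e r !=set0] =
    \bigcup_z (~` [set w | idla e S N w z] `&` [set w | tree_ball e r z]).
  apply/seteqP; split => w [z]; first by move=> [? ?]; exists z.
  by move=> _ [? ?]; exists z.
apply: countable_bigcupT_measurable; first exact: countable_tree.
move=> z; apply: measurableI; first by apply: measurableC; exact: measurable_idla.
have [rz|rz] := pselect (tree_ball e r z).
- by have -> : [set w : Omega | tree_ball e r z] = setT by apply/seteqP; split.
- by have -> : [set w : Omega | tree_ball e r z] = set0 by apply/seteqP; split.
Qed.

End Unhit.

(** * Numerical bounds and the quantitative estimate *)

Section Estimate.
Set Implicit Arguments.
Unset Strict Implicit.

(** For $x \le 1/2$ one has $1/(1-x) \le 1 + 2x \le e^{2x}$, so $(1-x)^{-N} \le e^{2Nx} \le e^{k/2}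
    \le B^k$, using $e^{1/2} \le 2 \le B$. *)
Lemma expr1B_ge (R : realType) (x B : R) N k : 0 <= x <= 2^-1 -> 2 <= B ->
  4 * (N%:R * x) <= k%:R -> B ^- k <= (1 - x) ^+ N.
Proof.
move=> /andP[x0 x1] B2 Nxk; have B0 : 0 < B by lra.
have e2 : expR (2^-1 : R) <= 2.
  rewrite -[expR _]invrK -expRN invf_ple ?posrE ?expR_gt0//.
  have := expR_ge1Dx (- 2^-1 : R); lra.
have le_expR : (1 + 2 * x) ^+ N <= B ^+ k.
  apply: (@le_trans _ _ (expR (2 * x) ^+ N)).
    by rewrite lerXn2r ?nnegrE ?expR_ge1Dx ?expR_ge0// addr_ge0// mulr_ge0.
  rewrite -expRM_natl; apply: (@le_trans _ _ (expR (k%:R * 2^-1))).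
    by rewrite ler_expR; lra.
  by rewrite expRM_natl lerXn2r ?nnegrE ?expR_ge0 ?(ltW B0)// (le_trans e2).
rewrite -[(1 - x) ^+ N]invrK lef_pV2 ?posrE ?exprn_gt0 ?invr_gt0 ?exprn_gt0//; last lra.
apply: le_trans le_expR; rewrite -exprVn lerXn2r ?nnegrE ?invr_ge0//; [lra|lra|].
rewrite -div1r ler_pdivrMr; last lra.
have : 0 <= x * (2^-1 - x) by rewrite mulr_ge0//; lra.
lra.
Qed.

(** $(1+x)^N \le e^{Nx} \le 1/(1 - Nx) \le 1 + 2Nx$, the last step because $Nx \le 1/2$. *)
Lemma expr1D_le (R : realType) (x : R) N : 0 <= x -> N%:R * x <= 2^-1 ->
  (1 + x) ^+ N <= 1 + 2 * (N%:R * x).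
Proof.
move=> x0 Nx; have Nx0 : 0 <= N%:R * x by rewrite mulr_ge0.
apply: (@le_trans _ _ (expR x ^+ N)).
  by rewrite lerXn2r ?nnegrE ?expR_ge1Dx ?expR_ge0// addr_ge0.
rewrite -expRM_natl -[expR _]invrK -expRN invf_ple ?posrE ?expR_gt0//; last lra.
apply: le_trans (expR_ge1Dx _); rewrite -div1r ler_pdivrMr; last lra.
have : 0 <= N%:R * x * (2^-1 - N%:R * x) by rewrite mulr_ge0//; lra.
lra.
Qed.

Context (q : nat) (T : homogeneousTree q) (R : realType) (e : T).
Context d (Omega : measurableType d) (P : probability Omega R).
Context (S : nat -> nat -> Omega -> T).
Hypothesis hsrw : forall n : nat, (1 <= n)%N -> simple_random_walk P e (S n).
Hypothesis hind : independent_processes P (fun n : nat => S n.+1).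
Hypothesis hq : (2 < q)%N.
Local Notation pr := (prob P).
Local Notation dist := (@graph_dist q T).
Local Notation beta := (hitF q R).
Local Notation B := (q.-1%:R : R).

Let B2 : 2 <= B. Proof. by rewrite ler_nat; lia. Qed.
Let B0 : 0 < B. Proof. by apply: lt_le_trans B2. Qed.

Lemma size_sphere_ge k : (q.-1 ^ k <= size (sphere e k))%N.
Proof.
by case: k => [//|k]; rewrite size_sphereS expnS leq_mul2r leq_pred orbT.
Qed.

Lemma expB_beta i j : B ^+ (i + j) * beta ^+ i = B ^+ j.
Proof.
by rewrite exprD mulrAC /hitF -exprMn divff ?gt_eqF// expr1n mul1r.
Qed.

Lemma pr_uncovered_ge l (r : R) : let n := (q.-1 ^ (2 * l))%N in
  (16 * q <= q.-1 ^ l)%N -> (n - l)%:R <= r ->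
  1 - (1 + 16 * q%:R) / B ^+ l <=
  pr [set w | (~` idla e S (ball_volume R e n) w) `&` tree_ball e r !=set0].
Proof.
move=> n hm hr; pose m := (q.-1 ^ l)%N.
have nE : n = (m * m)%N by rewrite /n /m -expnD mul2n addnn.
have lm : (l < m)%N by apply: ltn_expl; lia.
(* As $n = m^2$ and $m \ge 16 q$, level [s0] exceeds the cost exponent [4 * q * m] by at least [l];
   this surplus makes the mean large. *)
have n_ge : (4 * q * m + 4 * l <= n)%N.
  rewrite nE (@leq_trans (16 * q * m))//; last by rewrite leq_mul2r hm orbT.
  by nia.
pose s0 := (n - 3 * l)%N; pose N := ball_volume R e n.
have s0E : (s0 + 2 * l = n - l)%N by rewrite /s0; lia.
have [r0 ln] : (0 < n - l)%N /\ (l <= n)%N by clear -lm n_ge hq; nia.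
have s0_ge : (4 * q * m + l <= s0)%N by rewrite /s0; lia.
have mE : m%:R = B ^+ l by rewrite natrX.
have m0 : 0 < m%:R :> R by rewrite ltr0n; lia.
have mq : 16 * q%:R <= m%:R :> R by rewrite -natrM ler_nat.
have q0 : 0 <= q%:R :> R by [].
have NB : N%:R <= q%:R * B ^+ n.
  by rewrite -natrX -natrM ler_nat; exact: ball_volume_le.
(* [f] selects a descendant [2 * l] levels further out; off level [s0] its value is arbitrary. *)
have /choice[f hf] : forall x, exists z, dist e x = s0 ->
    dist e z = (n - l)%N /\ ancestor e s0 z = x.
  move=> x; have [xs|] := pselect (dist e x = s0); last by exists x.
  have [|z hz] := @exists_descendant q T e s0 (2 * l) x _ xs; first by lia.
  by exists z; rewrite -s0E.
pose s := sphere e s0; pose U x := unhit S N (f x).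
have fs x : x \in s -> dist (f x) e = (n - l)%N.
  by rewrite mem_sphere => /eqP xs; rewrite dist_sym (hf _ xs).1.
set H := beta ^+ (n - l).
have H0 : 0 <= H by rewrite exprn_ge0// hitF_ge0.
have beta2 : beta <= 2^-1 by rewrite lef_pV2// posrE.
have H2 : H <= 2^-1.
  apply: le_trans beta2; rewrite -[leRHS]expr1.
  by rewrite ler_wiXn2l ?hitF_ge0 ?hitF_le1// r0.
(* With $b = q - 1$, $N H \le q b^n b^{-(n-l)} = q b^l$. *)
have NH : N%:R * H <= q%:R * m%:R.
  apply: (@le_trans _ _ (q%:R * B ^+ n * H)); first exact: ler_wpM2r.
  by rewrite -mulrA mE -(expB_beta (n - l) l) subnK.
(* Bounds the probability that one walk hits two given chosen vertices, which are more than [2 * l]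
   apart. *)
pose delta := (H + H) * beta ^+ (2 * l).
have d0 : 0 <= delta by rewrite mulr_ge0 ?addr_ge0// exprn_ge0// hitF_ge0.
have Nd : N%:R * (4 * delta) <= 8 * q%:R / m%:R.
  have -> : N%:R * (4 * delta) = 8 * (N%:R * H * beta ^+ (2 * l)) by rewrite /delta; ring.
  rewrite -[leRHS]mulrA ler_wpM2l//.
  apply: (@le_trans _ _ (q%:R * m%:R * beta ^+ (2 * l))).
    by apply: ler_wpM2r NH; rewrite exprn_ge0// hitF_ge0.
  rewrite -mulrA ler_wpM2l// mul2n -addnn exprD mulrA mE.
  have := expB_beta l 0; rewrite addn0 expr0 => ->.
  by rewrite mul1r exprVn.
(* The assumption $16 q \le b^l$ is exactly what lets [expr1D_le] linearise the correlation
   factor. *)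
have y1 : 8 * q%:R / m%:R <= 2^-1 :> R.
  by rewrite ler_pdivrMr// -ler_pdivrMl ?invr_gt0// invrK mulrA -natrM.
have rho_le : (1 + 4 * delta) ^+ N <= 1 + 2 * (8 * q%:R / m%:R).
  apply: le_trans (expr1D_le _ _) _; first by rewrite mulr_ge0.
    by rewrite (le_trans Nd).
  by rewrite lerD2l ler_wpM2l.
have mU x : measurable (U x) by exact: (measurable_unhit hsrw).
have unhit_ge : B ^- (4 * q * m) <= (1 - H) ^+ N.
  by apply: expr1B_ge; rewrite ?H0// !natrM -[leRHS]mulrA ler_wpM2l.
(* There are at least $b^{s_0}$ chosen vertices, each missed with probability at least $b^{-4qm}$,
   and $s_0 \ge 4qm + l$. *)
have EX : m%:R <= \sum_(x <- s) pr (U x).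
  apply: (@le_trans _ _ (\sum_(x <- s) B ^- (4 * q * m))); last first.
    rewrite big_seq [leRHS]big_seq; apply: ler_sum => x xs.
    apply: (le_trans unhit_ge); apply: (pr_unhit_ge hsrw hind hq).
      by rewrite (le_trans H2)// invf_le1 ?ler1n.
    by rewrite fs.
  rewrite big_const_seq count_predT iter_addr_0 -[_ *+ size s]mulr_natl ler_pdivlMr ?exprn_gt0//.
  rewrite mE -exprD (@le_trans _ _ (B ^+ s0))//.
    by rewrite ler_weXn2l// ?(le_trans _ B2)// ?ler1n// addnC.
  by rewrite -natrX ler_nat size_sphere_ge.
have EX0 : 0 < \sum_(x <- s) pr (U x) by exact: lt_le_trans EX.
have := @quasi_independent_union _ _ _ P T s U ((1 + 4 * delta) ^+ N)
  (sphere_uniq e s0) mU EX0.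
rewrite exprn_ge0; last by rewrite addr_ge0// mulr_ge0.
move=> /(_ isT) H1.
have {}H1 : pr (\bigcap_(i in [set` s]) ~` U i) <= (1 + 16 * q%:R) / B ^+ l.
  apply: le_trans (H1 _) _.
    move=> x y xs ys xy; apply: (pr_unhit2_le hsrw hind hq); rewrite ?fs//.
    rewrite /delta ler_wpM2l ?addr_ge0// ler_wiXn2l ?hitF_ge0 ?hitF_le1//.
    move: xs ys; rewrite !mem_sphere => /eqP xs /eqP ys.
    apply/ltnW/(@dist_ancestor_neq q T e s0); first by rewrite (hf _ xs).1.
    by rewrite (hf _ xs).2 (hf _ ys).2.
  have : (\sum_(x <- s) pr (U x))^-1 <= m%:R^-1 by rewrite lef_pV2// posrE.
  move=> le_m; rewrite -mE [leRHS]mulrDl mul1r -addrA lerD// lerBlDl (le_trans rho_le)//.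
  by rewrite lerD2l !mulrA -natrM.
have mI : measurable (\bigcap_(i in [set` s]) ~` U i).
  apply: fin_bigcap_measurable; first by apply/finite_seqP; exists s.
  by move=> x _; exact: measurableC.
apply: (@le_trans _ _ (pr (~` \bigcap_(i in [set` s]) ~` U i))).
  by rewrite prC// lerD2l lerN2.
apply: pr_le; [exact: measurableC|exact: (measurable_uncovered hsrw)|].
(* A missed [f x] lies at level $n - l \le r$; this level is positive, so [f x] is not [e] and stays
   outside the cluster. *)
rewrite setC_bigcap => w [x xs]; rewrite setCK => wU; exists (f x); split.
  by apply: (unhit_sub _ wU); rewrite -dist_eq0 fs// -lt0n r0.
by rewrite /tree_ball/= dist_sym fs.
Qed.

End Estimate.

(** * The limsup event *)

Theorem proposition4p2 (R : realType) (q : nat) (hq : (3 <= q)%N)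
    (T : homogeneousTree q) (e : T)
    (d : measure_display) (Omega : measurableType d) (P : probability Omega R)
    (S : nat -> nat -> Omega -> T)
    (hsrw : forall n : nat, (1 <= n)%N -> simple_random_walk P e (S n))
    (hind : independent_processes P (fun n : nat => S n.+1))
    (C : R) (hC : C < 1 / (2 * ln (q%:R - 1))) :
  P (lim_sup_set (fun n : nat =>
       [set w | (~` idla e S (ball_volume R e n) w) `&`
                tree_ball e (n%:R - C * ln n%:R) !=set0])) = 1%E.
Proof.
apply: lim_sup_set_eq1 => [n|j eps eps0]; first exact: (measurable_uncovered hsrw).
have q1E : q%:R - 1 = q.-1%:R :> R by rewrite -subn1 natrB// (leq_trans _ hq).
have B1 : 1 < q.-1%:R :> R by rewrite ltr1n; lia.
have lnB : 0 < ln (q.-1%:R : R) by exact: ln_gt0.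
pose c : R := (1 + 16 * q%:R) / eps.
have c0 : 0 <= c by rewrite divr_ge0// ?ltW// addr_ge0// mulr_ge0.
(* The summands of [l] serve in turn to get $n \ge j$, to meet the size condition of the estimate,
   and to push the error below [eps]. *)
pose l := (j + 16 * q + Num.truncn c)%N.
have ll : (l < q.-1 ^ l)%N by apply: ltn_expl; lia.
have l2 : (l <= q.-1 ^ (2 * l))%N.
  by rewrite ltnW// (leq_trans ll)// leq_exp2l//; lia.
exists (q.-1 ^ (2 * l))%N; first by rewrite (leq_trans _ l2)// /l -addnA leq_addr.
apply: le_trans (pr_uncovered_ge hsrw hind hq _ _).
- rewrite lerD2l lerN2 ler_pdivrMr ?exprn_gt0 ?(lt_trans _ B1)//.
  rewrite [eps * _]mulrC -ler_pdivrMr// -/c -natrX (le_trans (ltW (truncnS_gt c)))//.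
  by rewrite ler_nat (leq_trans _ ll)// ltnS /l leq_addl.
- by rewrite ltnW// (leq_ltn_trans _ ll)// /l; lia.
(* Here $C \ln n = l \cdot 2 C \ln(q-1) \le l$; this is where the bound on [C] enters. *)
- rewrite natrB// lerD2l lerN2 natrX lnXn ?(lt_trans _ B1)//.
  rewrite -[_ *+ (2 * l)]mulr_natl natrM.
  move: hC; rewrite q1E ltr_pdivlMr ?mulr_gt0// => hC.
  have -> : C * (2 * l%:R * ln q.-1%:R) = l%:R * (C * (2 * ln q.-1%:R)) by ring.
  by rewrite ler_piMr// ltW.
Qed.
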